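(* Let $\{X_\ell,f_\ell\}_{\ell=1}^{\infty}$ be an inverse sequence of compact metric spaces and surjective continuous bonding functions, and let $g:\varprojlim\{X_\ell,f_\ell\}_{\ell=1}^{\infty}\to\varprojlim\{X_\ell,f_\ell\}_{\ell=1}^{\infty}$ be a continuous function. The following statements are equivalent. 1. There is a point $\mathbf x\in\varprojlim\{X_\ell,f_\ell\}_{\ell=1}^{\infty}$ such that $g(\mathbf x)=\mathbf x$. 2. There are sequences $(n_\ell)$ and $(m_\ell)$ of positive integers such that (i) $m_{k+1}\ge m_k$ and $n_{k+1}>n_k$ for each positive integer $k$, (ii) $m_k\ge n_k$ for each positive integer $k$, and there is a sequence $(H_\ell)$ of upper semicontinuous functions $H_\ell:X_{m_\ell}\multimap X_{n_\ell}$ such that (a) for each positive integer $k$ and for each $j\in\{1,2,\ldots,n_k\}$, $f_{j,n_r}(H_r(x))\subseteq f_{j,n_k}(H_k(f_{m_k,m_r}(x)))$ holds for each positive integer $r>k$ and for each $x\in X_{m_r}$, (b) for each positive integer $k$ and for each $j\in\{1,2,\ldots,n_k\}$, $p_j(g(\mathbf x))\in f_{j,n_k}(H_k(p_{m_k}(\mathbf x)))$ holds for each $\mathbf x\in\varprojlim\{X_\ell,f_\ell\}_{\ell=1}^{\infty}$, (c) for each positive integer $j$, $\lim_{k\to\infty}\operatorname{diam}(f_{j,n_k}(H_k(p_{m_k}(\mathbf x))))=0$ for any $\mathbf x\in\varprojlim\{X_\ell,f_\ell\}_{\ell=1}^{\infty}$, (d) for each positive integer $k$ and for each $j\in\{1,2,\ldots,n_k\}$,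 there is a point $x\in X_{m_k}$ such that $f_{j,m_k}(x)\in f_{j,n_k}(H_k(x))$.
   Context: For compact metric spaces $X,Y$, a set-valued function $F:X\multimap Y$ is a function from $X$ to the set $2^Y$ of non-empty closed subsets of $Y$; it is upper semicontinuous if for each open $V\subseteq Y$ the set $\{x\in X\mid F(x)\subseteq V\}$ is open in $X$. For continuous maps $f_\ell:X_{\ell+1}\to X_\ell$ between compact metric spaces, $\varprojlim\{X_\ell,f_\ell\}_{\ell=1}^\infty$ is the subspace of $\prod_{\ell=1}^\infty X_\ell$ of all $(x_1,x_2,\ldots)$ with $x_\ell=f_\ell(x_{\ell+1})$ for all $\ell$, and $p_n$ is its $n$-th coordinate projection. For $n<m$, $f_{n,m}=f_n\circ\cdots\circ f_{m-1}:X_m\to X_n$, and $f_{n,n}$ is the identity on $X_n$. In the limit in (c), $k$ ranges over those $k$ with $n_k\ge j$ (all sufficiently large $k$). *)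

(* Defs.v *)
From HB Require Import structures.
From mathcomp Require Import all_boot all_order all_algebra.
From mathcomp Require Import all_classical all_reals all_analysis.
Set Implicit Arguments. Unset Strict Implicit. Unset Printing Implicit Defensive.
Import Order.TTheory GRing.Theory Num.Theory.
Import numFieldNormedType.Exports.
Local Open Scope classical_set_scope.
Local Open Scope ring_scope.

(* All sequences are indexed from 0: [X l] is the space $X_{l+1}$, and the
   positive integers $n_k$, $m_k$, $j$ are all represented by their
   predecessors, so that "1 <= j <= n_k" reads [(j <= n k)%N]. *)

(* Real-valued [sup] is harmless here: [diam] is only meaningful on nonempty
   bounded sets, such as nonempty subsets of a compact space. It is 0 on the
   empty set. *)
Definition diam (R : realType) (T : metricType R) (A : set T) : R :=
  sup [set mdist z.1 z.2 | z in A `*` A].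

Definition set_valued (S T : topologicalType) (F : S -> set T) : Prop :=
  forall x, F x !=set0 /\ closed (F x).

Definition upper_semicontinuous (S T : topologicalType) (F : S -> set T) : Prop :=
  forall V : set T, open V -> open [set x | F x `<=` V].

Section InverseSequence.
Variables (R : realType) (X : nat -> metricType R) (f : forall l, X l.+1 -> X l).

Definition invlim_set : set (prod_topology X) :=
  [set x : prod_topology X | forall l, x l = @f l (x l.+1)].

(* [set_type A] carries the topology induced by the inclusion of [A]. *)
Definition invlim : topologicalType := set_type invlim_set.

Definition invlim_proj (l : nat) (x : invlim) : X l := set_val x l.

Fixpoint bond_add (n d : nat) : X (d + n)%N -> X n :=
  if d is d'.+1 return X (d + n)%N -> X n
  then fun x => bond_add (@f (d' + n)%N x) else id.

(* $f_{n,m} : X_m \to X_n$; the cast is along [m = (m - n) + n]. *)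
Definition bond (n m : nat) (le_nm : (n <= m)%N) (x : X m) : X n :=
  bond_add (ecast k (X k) (esym (subnK le_nm)) x).

(* $f_{j,n}(A)$, made total in [j] and [n]: it is empty when [n < j]. *)
Definition bond_image (j n : nat) (A : set (X n)) : set (X j) :=
  [set y | exists le_jn : (j <= n)%N, (bond le_jn @` A) y].
Arguments bond_image : clear implicits.

Lemma bond_irr n m (h h' : (n <= m)%N) x : bond h x = bond h' x.
Proof. by rewrite (bool_irrelevance h h'). Qed.

Lemma bondnn n (h : (n <= n)%N) x : bond h x = x.
Proof.
rewrite /bond; move: (esym (subnK h)).
by rewrite subnn => e; rewrite (eq_irrelevance e erefl).
Qed.

Lemma bondS n m (h : (n <= m)%N) (h' : (n <= m.+1)%N) (x : X m.+1) :
  bond h' x = bond h (f x).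
Proof.
rewrite /bond; move: (esym (subnK h)) (esym (subnK h')); rewrite subSn //.
move: (m - n)%N => d; move: {h h'} m x => m x e; subst m => e'.
by rewrite (eq_irrelevance e' erefl).
Qed.

Lemma bond_imageE j n (h : (j <= n)%N) A : bond_image j n A = bond h @` A.
Proof.
apply/seteqP; split=> [y [h'] | y hy]; last by exists h.
by rewrite (bool_irrelevance h' h).
Qed.

End InverseSequence.

Arguments bond {R X} f {n m} le_nm x.
Arguments bond_image {R X} f j {n} A _.
Arguments invlim_proj {R X f} l x.

Lemma nondecr_le (m : nat -> nat) (hm : forall k, (m k <= m k.+1)%N) (k r : nat) :
  (k < r)%N -> (m k <= m r)%N.
Proof.
by move=> /ltnW; apply: (@homo_leq _ m leq) => // y x z; exact: leq_trans.
Qed.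

(* Main.v *)
(* If the H_k exist, the sets F_k of points z with p_{n_k}(z) in H_k(p_{m_k}(z))
   are nonempty by (d), closed because an upper semicontinuous closed-valued
   function has a closed graph, and decreasing by (a); by compactness they share
   a point z.  For each j, p_j(z) and p_j(g(z)) both lie in
   f_{j,n_k}(H_k(p_{m_k}(z))), whose diameter tends to 0, so g(z) = z.
   Conversely, a fixed point makes n_k = m_k = k and H_k = p_k o g o p_k^{-1}
   satisfy (a)-(d); (c) holds because the fibres of p_k through a point shrink
   to that point, and only (d) uses the fixed point. *)
Require Import Defs.
From HB Require Import structures.
From mathcomp Require Import all_boot all_order all_algebra.
From mathcomp Require Import all_classical all_reals all_analysis.
Import Order.TTheory GRing.Theory Num.Theory.
Import numFieldNormedType.Exports.
Local Open Scope classical_set_scope.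
Local Open Scope ring_scope.

(** * Closed sets and compactness *)

Lemma closed_equalizer {S T : topologicalType} (u v : S -> T) :
  hausdorff_space T -> continuous u -> continuous v ->
  closed [set x | u x = v x].
Proof.
move=> hT cu cv p clp; apply: hT => U V pU pV.
have nU : nbhs p (u @^-1` U) by exact: cu.
have nV : nbhs p (v @^-1` V) by exact: cv.
have [x [/= uvx [Ux Vx]]] := clp _ (filterI nU nV).
by exists (u x); split => //; rewrite uvx.
Qed.

(** If [v p] is not in [F (u p)], regularity gives a neighbourhood [B] of [v p] whose closure misses
    [F (u p)]. Near [p], semicontinuity keeps [F (u z)] off that closure while [v z] stays in [B],
    so [p] is not a limit point. *)
Lemma closed_usc_graph {S T Z : topologicalType} (F : S -> set T)
    (u : Z -> S) (v : Z -> T) :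
  regular_space T -> (forall x, closed (F x)) -> upper_semicontinuous F ->
  continuous u -> continuous v -> closed [set z | F (u z) (v z)].
Proof.
move=> rT clF uscF cu cv p clp /=; apply: contrapT => nFp.
have nbF : nbhs (v p) (~` F (u p)).
  by apply: open_nbhs_nbhs; split => //; exact/closed_openC/clF.
have [B nB BF] := rT _ _ nbF.
have nuV : nbhs p (u @^-1` [set x | F x `<=` ~` closure B]).
  apply: cu; apply: open_nbhs_nbhs; split; first exact/uscF/closed_openC/closed_closure.
  by move=> y Fy /BF.
have nvB : nbhs p (v @^-1` B) by exact: cv.
have [z [/= Fz [Vz Bz]]] := clp _ (filterI nuV nvB).
exact: Vz Fz (subset_closure Bz).
Qed.

Lemma compact_set_type {T : topologicalType} (A : set T) :
  compact A -> compact [set: set_type A].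
Proof.
move=> cA F PF _; have FA : (@set_val T A @ F) A.
  by apply: nearW => -[x Ax]; exact: set_mem.
have [p [Ap clp]] := cA _ _ FA.
(* In the induced topology a neighbourhood contains the trace of an open [W], so clustering is
   tested on the image filter. *)
exists (exist _ p (mem_set Ap)); split => // P B FP [_ [[W oW <-] Wp WB]].
have nW : nbhs p W by exact: open_nbhs_nbhs.
have FP' : (@set_val T A @ F) (set_val @` P) by apply: (@filterS _ F _ P) => // x Px; exists x.
have [_ [[x Px <-] Wx]] := clp _ _ FP' nW.
by exists x; split => //; exact: WB.
Qed.

(** The sets [F k] form a base of a proper filter; a cluster point of it is adherent to each [F k],
    hence in it. *)
Lemma compact_decreasing_closed {T : topologicalType} (F : nat -> set T) :
  compact [set: T] -> (forall k, closed (F k)) -> (forall k, F k !=set0) ->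
  (forall k r, (k <= r)%N -> F r `<=` F k) -> exists z, forall k, F k z.
Proof.
move=> cT clF F0 decF.
have PF : ProperFilter (filter_from [set: nat] F).
  apply: filter_from_proper => //; apply: filter_from_filter; first by exists 0%N.
  move=> i j _ _; exists (maxn i j) => // x Fx.
  by split; apply: decF Fx; rewrite ?leq_maxl ?leq_maxr.
have [z [_ clz]] := cT _ PF filterT.
exists z => k; apply: clF => B nB.
by apply: clz nB; exists k.
Qed.

(** * Diameters in a compact metric space *)

Section Diameter.
Context {R : realType} {T : metricType R}.
Hypothesis compactT : compact [set: T].

(** Boundedness makes the [sup] in [diam] a genuine upper bound. On the unit ball around [x] every
    [M] above [mdist a x + 1] works, and compactness makes the choice of [M] uniform. *)
Lemma mdist_bounded (a : T) : exists M : R, forall x, mdist a x <= M.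
Proof.
have /compact_near_coveringP cov := compactT.
suff /filter_ex[M HM] : \forall M \near +oo, [set: T] `<=` [set x | mdist a x <= M].
  by exists M => x; exact: HM.
apply: cov => x _; near=> y M => /=.
have xy : mdist x y < 1.
  near: y; have := nbhsx_ballx x 1 ltr01.
  by apply: filterS => y; rewrite ballEmdist.
apply: (le_trans (metric_triangle _ x _)).
by apply: (le_trans (lerD (lexx _) (ltW xy))); near: M; apply: nbhs_pinfty_ge; exact: num_real.
Unshelve. all: by end_near. Qed.

Lemma mdist_le_diam (A : set T) x y : A x -> A y -> mdist x y <= diam A.
Proof.
move=> Ax Ay; apply: ub_le_sup; last by exists (x, y).
have [M HM] := mdist_bounded x; exists (M + M) => _ [[u v] _ <-] /=.
by rewrite (le_trans (metric_triangle _ x _))// lerD// metric_sym.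
Qed.

Lemma diam_le (A : set T) (e : R) : A !=set0 ->
  (forall x y, A x -> A y -> mdist x y <= e) -> diam A <= e.
Proof.
move=> [a Aa] Ae; apply: ge_sup; first by exists (mdist a a); exists (a, a).
by move=> _ [[u v] [/= Au Av] <-]; exact: Ae.
Qed.

End Diameter.

(** * Composed bonding maps and points of the limit *)

Section Bond.
Context {R : realType} {X : nat -> metricType R} {f : forall l, X l.+1 -> X l}.

Lemma bond_comp {j n m} (jn : (j <= n)%N) (nm : (n <= m)%N) (jm : (j <= m)%N)
    (x : X m) : bond f jn (bond f nm x) = bond f jm x.
Proof.
elim: m nm jm x => [|m IH] nm jm x.
  by move: jn nm jm; case: n => [|//] jn nm jm; rewrite bondnn; exact: bond_irr.
(* [bondS] applies only when [n <= m]. In the remaining case the equation is reversed so that its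
   elimination replaces [n] by [m.+1] in the types. *)
have [/esym nE|nm'] := eqVneq n m.+1.
  by case: n / nE jn nm IH => jn nm _; rewrite bondnn; exact: bond_irr.
have nm1 : (n <= m)%N by rewrite -ltnS ltn_neqAle nm' nm.
rewrite (bondS _ nm1) (bondS _ (leq_trans jn nm1)).
exact: IH.
Qed.

Lemma bond_succ {n m} (h : (n.+1 <= m)%N) (h' : (n <= m)%N) (x : X m) :
  f n (bond f h x) = bond f h' x.
Proof. by rewrite -(bond_comp (leqnSn n) h h') (bondS _ (leqnn n)) bondnn. Qed.

Lemma bond_proj {n m} (h : (n <= m)%N) (x : invlim f) :
  bond f h (invlim_proj m x) = invlim_proj n x.
Proof.
elim: m h => [|m IH] h; first by case: n h => [|//] h; rewrite bondnn.
have [/esym nE|nm'] := eqVneq n m.+1; first by case: n / nE h IH => h _; rewrite bondnn.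
have nm1 : (n <= m)%N by rewrite -ltnS ltn_neqAle nm' h.
rewrite (bondS _ nm1) -[RHS](IH nm1); congr (bond f nm1 _).
exact/esym/(set_mem (proj2_sig x) m).
Qed.

Lemma bond_image_proj {j n} {A : set (X n)} {x : invlim f} : (j <= n)%N ->
  A (invlim_proj n x) -> bond_image f j A (invlim_proj j x).
Proof. by move=> jn Ax; exists jn; exists (invlim_proj n x); rewrite ?bond_proj. Qed.

(** A thread through [y] has the bonds of [y] as coordinates up to [n] and successively chosen
    preimages beyond. *)
Lemma invlim_proj_surj {n} (y : X n) :
  (forall l (y : X l), exists x : X l.+1, f l x = y) ->
  exists x : invlim f, invlim_proj n x = y.
Proof.
move=> surj_f; pose s l x := projT1 (cid (surj_f l x)).
have fs l x : f l (s l x) = x by exact: (projT2 (cid (surj_f l x))).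
(* Matching on the reflection view supplies the proof of [k.+1 <= n] that [bond] takes as an
   argument. *)
pose z := fix z l : X l := match l return X l with
  | 0 => bond f (leq0n n) y
  | k.+1 => if (k.+1 <= n)%N =P true is ReflectT h then bond f h y else s k (z k)
  end.
have zE l (h : (l <= n)%N) : z l = bond f h y.
  case: l h => [|l] h; first exact: bond_irr.
  by rewrite /z; case: eqP => [h'|//]; exact: bond_irr.
have fz : invlim_set f z.
  move=> l; rewrite [z l.+1]/z -/z; case: eqP => [h|_]; last by rewrite fs.
  by rewrite (bond_succ _ (ltnW h)); exact: zE.
by exists (exist _ z (mem_set fz)); rewrite -[RHS](bondnn f (leqnn n)); exact: zE.
Qed.

End Bond.

(** * Topology of the inverse limit *)

Section InverseLimit.
Context {R : realType} {X : nat -> metricType R} {f : forall l, X l.+1 -> X l}.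

Lemma invlim_proj_continuous n : continuous (@invlim_proj R X f n).
Proof.
move=> x; apply: (@continuous_comp _ _ _ set_val (fun z : prod_topology X => z n)).
  exact: initial_continuous.
exact: (@proj_continuous nat X n).
Qed.

(** The limit is an intersection of equalizers, hence closed in the Tychonoff product. *)
Lemma invlim_compact : (forall l, compact [set: X l]) ->
  (forall l, continuous (f l)) -> compact [set: invlim f].
Proof.
move=> compactX cf; apply: compact_set_type.
apply: (@subclosed_compact _ _ [set x : prod_topology X | forall l, [set: X l] (x l)]).
- rewrite (_ : invlim_set f = \bigcap_l [set x : prod_topology X | x l = f l (x l.+1)]).
    apply: closed_bigI => l _; apply: closed_equalizer; first exact: metric_hausdorff.
      exact: (@proj_continuous nat X l).
    move=> x; apply: (@continuous_comp _ _ _ (fun z : prod_topology X => z l.+1)).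
      exact: (@proj_continuous nat X l.+1).
    exact: cf.
  by apply/seteqP; split=> x; [move=> xf l _; exact: xf|move=> xf l; exact: xf].
- exact: (@tychonoff nat X (fun=> setT) compactX).
- by [].
Qed.

(** Agreement with [x] in coordinate [k] forces agreement in all earlier ones, so the filter [G] of
    fibres through [x] converges to [x] in each coordinate, hence in the product. *)
Lemma invlim_nbhs (x : invlim f) (U : set (invlim f)) : nbhs x U ->
  exists N, forall k y, (N <= k)%N -> invlim_proj k y = invlim_proj k x -> U y.
Proof.
pose G : set_system (invlim f) :=
  filter_from [set: nat] (fun N => [set y | invlim_proj N y = invlim_proj N x]).
have eq_le N k (y : invlim f) : (N <= k)%N ->
    invlim_proj k y = invlim_proj k x -> invlim_proj N y = invlim_proj N x.
  by move=> Nk yx; rewrite -(bond_proj Nk y) yx bond_proj.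
have FG : Filter G.
  apply: filter_from_filter; first by exists 0%N.
  move=> i j _ _; exists (maxn i j) => // y yx.
  by split; apply: eq_le yx; rewrite ?leq_maxl ?leq_maxr.
suff Gx : (@set_val _ (invlim_set f) @ G) --> (set_val x : prod_topology X).
  move=> [_ [[W oW <-] Wx WU]].
  have [N _ GN] : G (set_val @^-1` W) by apply: Gx; exact: open_nbhs_nbhs.
  by exists N => k y Nk yx; apply: WU; apply: GN; exact: eq_le yx.
apply/cvg_sup => N V [_ [[W oW <-] Wx WV]].
by exists N => // y yx; apply: WV; rewrite /= -/(invlim_proj N y) yx.
Qed.

End InverseLimit.

(** * Set-valued approximations of [g] and fixed points *)

Section FixedPoint.
Context {R : realType} {X : nat -> metricType R} {f : forall l, X l.+1 -> X l}.
Variable g : invlim f -> invlim f.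
Hypothesis compactX : forall l, compact [set: X l].
Hypothesis continuous_f : forall l, continuous (f l).
Hypothesis surjective_f : forall l (y : X l), exists x : X l.+1, f l x = y.
Hypothesis continuous_g : continuous g.

Definition induced {k : nat} (x : X k) : set (X k) :=
  (fun z => invlim_proj k (g z)) @` [set z | invlim_proj k z = x].

Let proj_g_continuous k : continuous (fun z => invlim_proj k (g z)).
Proof. by move=> z; apply: continuous_comp (continuous_g z) (invlim_proj_continuous k _). Qed.

(** Fibres of the projection are nonempty by surjectivity and compact because closed in the limit;
    continuous images keep both properties. *)
Lemma induced_set_valued k : set_valued (@induced k).
Proof.
move=> x; split.
  by have [z zx] := invlim_proj_surj x surjective_f; exists (invlim_proj k (g z)), z.
apply: compact_closed; first exact: metric_hausdorff.
apply: continuous_compact.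
  by apply: continuous_subspaceT; exact: proj_g_continuous.
apply: (subclosed_compact _ (invlim_compact compactX continuous_f)) => //.
apply: (@closed_equalizer _ _ (invlim_proj k) (fun=> x)).
- exact: metric_hausdorff.
- exact: invlim_proj_continuous.
- exact: cst_continuous.
Qed.

(** The complement of the set to be shown open is the projection of the closed set of [z] with
    [invlim_proj k (g z)] outside [V]; by compactness that projection is closed. *)
Lemma induced_usc k : upper_semicontinuous (@induced k).
Proof.
move=> V oV.
rewrite (_ : [set x | _] =
    ~` (invlim_proj k @` ((fun z => invlim_proj k (g z)) @^-1` (~` V)))); last first.
  apply/seteqP; split=> x /= xV.
    by move=> [z gzV zx]; apply/gzV/xV; exists z.
  move=> _ [z zx <-]; apply: contrapT => gzV.
  by apply: xV; exists z.
apply: closed_openC; apply: compact_closed; first exact: metric_hausdorff.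
apply: continuous_compact.
  by apply: continuous_subspaceT; exact: invlim_proj_continuous.
apply: (subclosed_compact _ (invlim_compact compactX continuous_f)) => //.
apply: closed_comp => [z _|]; first exact: proj_g_continuous.
exact: open_closedC.
Qed.

(** Bonds commute with projections; this reduces diameters of images of [induced] to the spread of
    the [j]-th coordinate of [g] over a fibre. *)
Lemma bond_image_induced {j k} {x : invlim f} : (j <= k)%N ->
  bond_image f j (induced (invlim_proj k x)) `<=`
  [set invlim_proj j (g y) | y in [set y | invlim_proj k y = invlim_proj k x]].
Proof.
move=> jk _ [h [_ [y yx <-] <-]]; exists y => //.
by rewrite bond_proj.
Qed.

Lemma induced_diam_cvg j (x : invlim f) :
  (fun k => diam (bond_image f j (induced (invlim_proj k x)))) @ \oo --> (0 : R).
Proof.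
apply/cvgrPdist_le => e e0.
(* Half of [e], because two points of the image are compared through [invlim_proj j (g x)]. *)
pose U := [set y | mdist (invlim_proj j (g x)) (invlim_proj j (g y)) < e / 2].
have /invlim_nbhs[N NU] : nbhs x U.
  rewrite /U -[X in nbhs _ X]/((fun z => invlim_proj j (g z)) @^-1`
    [set v | mdist (invlim_proj j (g x)) v < e / 2]).
  apply: proj_g_continuous; rewrite -ballEmdist; apply: nbhsx_ballx.
  by rewrite divr_gt0.
(* From [j] on, [bond_image] is a true image rather than empty; from [N] on, the fibre through [x]
   lies in [U]. *)
exists (maxn j N) => // k /=; rewrite geq_max => /andP[jk Nk].
have gxk : bond_image f j (induced (invlim_proj k x)) (invlim_proj j (g x)).
  by apply: bond_image_proj => //; exists x.
have d0 : 0 <= diam (bond_image f j (induced (invlim_proj k x))).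
  by rewrite -(mdistxx (invlim_proj j (g x))); exact: mdist_le_diam.
rewrite sub0r normrN ger0_norm//.
apply: diam_le; first by exists (invlim_proj j (g x)).
move=> _ _ /(bond_image_induced jk)[u /= ux <-] /(bond_image_induced jk)[v /= vx <-].
rewrite (le_trans (metric_triangle _ (invlim_proj j (g x)) _))// [leRHS]splitr.
rewrite lerD//; first by rewrite metric_sym ltW//; exact: (NU k).
by rewrite ltW//; exact: (NU k).
Qed.

(** (a) and (d) at [j = n k], where the outer bond is the identity, produce the common point [z];
    (b) and (c) then identify each coordinate of [g z] with that of [z]. *)
Lemma fixpoint_of_approximation (n m : nat -> nat)
    (hm : forall k, (m k <= m k.+1)%N) (hn : forall k, (n k < n k.+1)%N)
    (hnm : forall k, (n k <= m k)%N) (H : forall k, X (m k) -> set (X (n k))) :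
  (forall k, set_valued (H k) /\ upper_semicontinuous (H k)) ->
  (forall k j, (j <= n k)%N -> forall r (hkr : (k < r)%N) (x : X (m r)),
     bond_image f j (H r x) `<=`
     bond_image f j (H k (bond f (nondecr_le hm hkr) x))) ->
  (forall k j, (j <= n k)%N -> forall x : invlim f,
     bond_image f j (H k (invlim_proj (m k) x)) (invlim_proj j (g x))) ->
  (forall j (x : invlim f),
     (fun k => diam (bond_image f j (H k (invlim_proj (m k) x)))) @ \oo --> (0 : R)) ->
  (forall k j (hj : (j <= n k)%N), exists x : X (m k),
     bond_image f j (H k x) (bond f (leq_trans hj (hnm k)) x)) ->
  exists x, g x = x.
Proof.
move=> uscH Ha Hb Hc Hd.
pose F k := [set z : invlim f | H k (invlim_proj (m k) z) (invlim_proj (n k) z)].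
have [z Fz] : exists z, forall k, F k z.
  apply: compact_decreasing_closed; first exact: invlim_compact.
  - move=> k; have [Hk1 Hk2] := uscH k.
    apply: closed_usc_graph => //; [exact: uniform_regular|by move=> x; have [] := Hk1 x| |];
      exact: invlim_proj_continuous.
  (* The point given by (d) is lifted to a point of the limit, which then lies in [F k]. *)
  - move=> k; have [x] := Hd k (n k) (leqnn _).
    have [z <-] := invlim_proj_surj x surjective_f.
    rewrite bond_proj (bond_imageE f (leqnn (n k))) => -[y Hy].
    by rewrite bondnn => yE; exists z; rewrite /F /= -yE.
  (* Pushing coordinate [n r] of [z] down to [n k] lands, by (a), in [H k] at coordinate [m k] of
     [z]. *)
  - move=> k r; rewrite leq_eqVlt => /orP[/eqP->//|kr] z Fz.
    have nkr : (n k <= n r)%N by apply: nondecr_le kr => i; exact: ltnW.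
    have := Ha k (n k) (leqnn _) r kr (invlim_proj (m r) z) _ (bond_image_proj nkr Fz).
    by rewrite bond_proj (bond_imageE f (leqnn (n k))) => -[y Hy]; rewrite bondnn /F /= => <-.
have n_ge k : (k <= n k)%N by elim: k => // k IH; exact: leq_ltn_trans (hn k).
exists z; apply/val_inj/functional_extensionality_dep => j; apply: mdist_positivity.
apply/eqP; rewrite eq_le mdist_ge0 andbT; apply/ler_addgt0Pr => e e0; rewrite add0r.
have /cvgr_lt/(_ _ e0)[N _ HN] := Hc j z.
(* At index [maxn N j] the diameter is below [e], and [n] there is at least [j], so both [j]-th
   coordinates lie in the image. *)
have /HN/ltW : (N <= maxn N j)%N by rewrite leq_maxl.
apply: le_trans; apply: mdist_le_diam => //; last apply: bond_image_proj; last exact: Fz.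
  by apply: Hb; rewrite (leq_trans _ (n_ge _))// leq_maxr.
by rewrite (leq_trans _ (n_ge _))// leq_maxr.
Qed.

End FixedPoint.

Theorem theorem4p8 (R : realType) (X : nat -> metricType R)
    (f : forall l, X l.+1 -> X l) (g : invlim f -> invlim f)
    (compactX : forall l, compact [set: X l])
    (continuous_f : forall l, continuous (f l))
    (surjective_f : forall l (y : X l), exists x : X l.+1, f l x = y)
    (continuous_g : continuous g) :
  (exists x : invlim f, g x = x)
  <->
  (exists (n m : nat -> nat)
     (hm : forall k, (m k <= m k.+1)%N)
     (hn : forall k, (n k < n k.+1)%N)
     (hnm : forall k, (n k <= m k)%N)
     (H : forall k, X (m k) -> set (X (n k))),
     (forall k, set_valued (H k) /\ upper_semicontinuous (H k)) /\
     (forall k j, (j <= n k)%N -> forall r (hkr : (k < r)%N) (x : X (m r)),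
        bond_image f j (H r x) `<=`
        bond_image f j (H k (bond f (nondecr_le hm hkr) x))) /\
     (forall k j, (j <= n k)%N -> forall x : invlim f,
        bond_image f j (H k (invlim_proj (m k) x)) (invlim_proj j (g x))) /\
     (forall j (x : invlim f),
        (fun k => diam (bond_image f j (H k (invlim_proj (m k) x)))) @ \oo --> (0 : R)) /\
     (forall k j (hj : (j <= n k)%N), exists x : X (m k),
        bond_image f j (H k x) (bond f (leq_trans hj (hnm k)) x))).
Proof.
split=> [[x gx]|[n [m [hm [hn [hnm [H [Husc [Ha [Hb [Hc Hd]]]]]]]]]]]; last first.
  by apply: fixpoint_of_approximation Husc Ha Hb Hc Hd.
exists id, id, leqnSn, ltnSn, leqnn, (@induced R X f g); split=> [k|].
  by split; [exact: induced_set_valued|exact: induced_usc].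
(* For (a): a point of the limit over [y] at level [r] also lies over the bond of [y] at level [k],
   so its image under [g] counts on both sides. *)
split=> [k j jk r kr y _ [h [_ [z zx <-] <-]]|].
  rewrite bond_proj; apply: bond_image_proj => //.
  by exists z => //=; rewrite -(bond_proj (ltnW kr)) zx; exact: bond_irr.
split=> [k j jk y|]; first by apply: bond_image_proj => //; exists y.
split=> [j y|k j jk]; first exact: induced_diam_cvg.
(* For (d): since [g x = x], the [k]-th coordinate of [x] belongs to its own image under
   [induced]. *)
exists (invlim_proj k x); rewrite bond_proj; apply: bond_image_proj => //.
by exists x; rewrite ?gx.
Qed.
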